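(* Consider the $N$-player aggregative game, the communication digraph $\mathcal{G}$ with weights $a_{ij}$ and Laplacian $L$, and the maps $G_i$ described in the context, and suppose that assumptions A1--A5 stated in the context hold, with constants $\mu,\kappa_1,\kappa_2,\kappa_3>0$. Let $\kappa=\kappa_1+\kappa_2\kappa_3$, let $\lambda_2$ be the smallest positive eigenvalue of $\frac12(L+L^T)$, and let $\alpha,\beta$ satisfy $$0<\alpha<\frac{2\mu\beta\lambda_2-4\kappa_2\kappa_3}{\kappa^2\beta\lambda_2+2\mu\kappa_2\kappa_3},\qquad \beta>\frac{2\kappa_2\kappa_3}{\mu\lambda_2}.$$ Then the distributed continuous-time algorithm, for $i=1,\dots,N$, $$\dot{x}_i=P_{\Omega_i}\big(x_i-\alpha G_i(x_i,\eta_i)\big)-x_i,\quad x_i(0)\in\Omega_i,$$ $$\dot{\theta}_i=\beta\sum_{j=1}^N a_{ij}(\eta_j-\eta_i),\quad \theta_i(0)=\mathbf{0}_m,$$ $$\eta_i=\theta_i+\varphi_i(x_i),$$ converges to the Nash equilibrium $\bm{x}^*$ of the game with an exponential convergence rate; that is, there is $\gamma>0$ such that for every solution of the algorithm on $[0,\infty)$ there is a constant $C\ge0$ with $\|\bm{x}(t)-\bm{x}^*\|\le Ce^{-\gamma t}$ for all $t\ge0$, where $\bm{x}(t)=col(x_1(t),\dots,x_N(t))$.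
   Context: Notation: $\|\cdot\|$ is the Euclidean norm, $\mathbf{1}_N=(1,\dots,1)^T\in\mathbb{R}^N$, $\mathbf{0}_m$ is the zero vector of $\mathbb{R}^m$, $\otimes$ is the Kronecker product, $col(x_1,\dots,x_N)=(x_1^T,\dots,x_N^T)^T$, and for a closed convex set $C$, $P_C(x)=\mathrm{argmin}_{y\in C}\|x-y\|$. Game: Let $N\ge 2$ and $\mathcal{V}=\{1,\dots,N\}$. Player $i\in\mathcal{V}$ chooses $x_i$ in a strategy set $\Omega_i\subset\mathbb{R}^{n_i}$. Put $n=\sum_i n_i$, $\Omega=\Omega_1\times\cdots\times\Omega_N\subset\mathbb{R}^n$, $\bm{x}=col(x_1,\dots,x_N)$, and let $x_{-i}$ be $\bm{x}$ with $x_i$ removed. Given maps $\varphi_i:\mathbb{R}^{n_i}\to\mathbb{R}^m$ and functions $\vartheta_i:\mathbb{R}^{n_i+m}\to\mathbb{R}$, the aggregation is $\sigma(\bm{x})=\frac1N\sum_{i=1}^N\varphi_i(x_i)\in\mathbb{R}^m$ and player $i$'s cost to be minimized is $J_i(x_i,x_{-i})=\vartheta_i(x_i,\sigma(\bm{x}))$. A strategy profile $\bm{x}^*\in\Omega$ is a Nash equilibrium if $J_i(x_i^*,x_{-i}^* )\le J_i(y_i,x_{-i}^* )$ for all $y_i\in\Omega_i$ and all $i\in\mathcal{V}$. Maps: For $x_i\in\mathbb{R}^{n_i}$ and $\eta_i\in\mathbb{R}^m$, $G_i(x_i,\eta_i)\in\mathbb{R}^{n_i}$ is the gradient $\nabla_{x_i}J_i(\cdot,x_{-i})$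 with $\sigma(\bm{x})$ replaced by $\eta_i$, i.e. $G_i(x_i,\eta_i)=\nabla_{x_i}\vartheta_i(x_i,\eta_i)+\frac1N (D\varphi_i(x_i))^T\nabla_\sigma\vartheta_i(x_i,\eta_i)$, where $D\varphi_i$ is the Jacobian and $\nabla_{x_i}\vartheta_i$, $\nabla_\sigma\vartheta_i$ are the partial gradients of $\vartheta_i$ in its first and second argument (assumed to exist so that the chain rule holds). Put $\bm{\eta}=col(\eta_1,\dots,\eta_N)\in\mathbb{R}^{mN}$ and $G(\bm{x},\bm{\eta})=col(G_1(x_1,\eta_1),\dots,G_N(x_N,\eta_N))$. The pseudo-gradient is $F(\bm{x})=col(\nabla_{x_1}J_1(\cdot,x_{-1}),\dots,\nabla_{x_N}J_N(\cdot,x_{-N}))$, so that $F(\bm{x})=G(\bm{x},\mathbf{1}_N\otimes\sigma(\bm{x}))$. Graph: $\mathcal{G}$ is a directed graph on $\mathcal{V}$ with adjacency matrix $[a_{ij}]$, where $a_{ij}>0$ if $(j,i)$ is an edge (agent $i$ can receive information from $j$) and $a_{ij}=0$ otherwise. Its Laplacian is $L=\mathrm{diag}\{d_{\rm in}^1,\dots,d_{\rm in}^N\}-[a_{ij}]$ with $d_{\rm in}^i=\sum_j a_{ij}$; put $d_{\rm out}^i=\sum_j a_{ji}$. $\mathcal{G}$ is weight-balanced if $d_{\rm in}^i=d_{\rm out}^i$ for all $i$. Assumptions: A1: each $\Omega_i$ is nonempty, convex and closed. A2: for each $i$, $J_i(x_i,x_{-i})$ and $\varphi_i(x_i)$ are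 differentiable with respect to $x_i$. A3: $F$ is $\mu$-strongly monotone on $\Omega$ for some $\mu>0$: $(\bm{x}-\bm{y})^T(F(\bm{x})-F(\bm{y}))\ge\mu\|\bm{x}-\bm{y}\|^2$ for all $\bm{x},\bm{y}\in\Omega$. A4: for some constants $\kappa_1,\kappa_2,\kappa_3>0$, $G(\bm{x},\bm{\eta})$ is $\kappa_1$-Lipschitz in $\bm{x}\in\Omega$ (for every $\bm{\eta}$) and $\kappa_2$-Lipschitz in $\bm{\eta}\in\mathbb{R}^{mN}$ (for every $\bm{x}\in\Omega$), and each $\varphi_i$ is $\kappa_3$-Lipschitz on $\Omega_i$. A5: $\mathcal{G}$ is strongly connected and weight-balanced. Under A1--A4 it is known that the game has a unique Nash equilibrium $\bm{x}^*$. *)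

(* Defs.v *)
From mathcomp Require Import all_boot all_order all_algebra.
From mathcomp Require Import all_classical all_reals all_analysis.
Import Order.TTheory GRing.Theory Num.Theory.
Import numFieldNormedType.Exports.

Set Implicit Arguments.
Unset Strict Implicit.
Unset Printing Implicit Defensive.

Local Open Scope classical_set_scope.
Local Open Scope ring_scope.

(* Vectors are row vectors, as in the library's
   Jacobian ['J f x], for which ['D_v f x = v *m 'J f x]: the usual Jacobian
   matrix acting on columns is the transpose of ['J f x]. *)

Definition dotv (R : realType) (n : nat) (u v : 'rV[R]_n) : R :=
  \sum_(j < n) u 0 j * v 0 j.

(* The library norm [`|v|] of a row vector is the sup norm. *)
Definition enorm (R : realType) (n : nat) (v : 'rV[R]_n) : R :=
  Num.sqrt (dotv v v).

Definition stack (R : realType) (N : nat) (n : 'I_N -> nat)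
    (x : forall i, 'rV[R]_(n i)) : 'rV[R]_(\sum_(i < N) n i) :=
  \mxrow_(i < N) x i.

Definition grad (R : realType) (n : nat) (f : 'rV[R]_n -> R) (x : 'rV[R]_n) :
    'rV[R]_n :=
  \row_(j < n) 'D_(delta_mx 0 j) f x.

Definition eproj (R : realType) (n : nat) (C : set 'rV[R]_n) (z : 'rV[R]_n) :
    'rV[R]_n :=
  get [set y | C y /\ forall w, C w -> enorm (z - y) <= enorm (z - w)].

Record game (R : realType) (N m : nat) := Game {
  gdim : 'I_N -> nat;
  strat : forall i, set 'rV[R]_(gdim i);
  phi : forall i, 'rV[R]_(gdim i) -> 'rV[R]_m;
  vtheta : forall i, 'rV[R]_(gdim i) -> 'rV[R]_m -> R }.

Arguments strat {R N m} g i.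
Arguments phi {R N m} g i.
Arguments vtheta {R N m} g i.

Definition profile (R : realType) (N m : nat) (g : game R N m) : Type :=
  forall i : 'I_N, 'rV[R]_(gdim g i).

Definition feasible (R : realType) (N m : nat) (g : game R N m) :
    set (profile g) :=
  [set x | forall i, strat g i (x i)].

Definition sigma (R : realType) (N m : nat) (g : game R N m) (x : profile g) :
    'rV[R]_m :=
  N%:R^-1 *: \sum_(i < N) phi g i (x i).

Definition cost (R : realType) (N m : nat) (g : game R N m) (i : 'I_N)
    (x : profile g) : R :=
  vtheta g i (x i) (sigma x).

(* The map y |-> J_i(y, x_{-i}); [dfwith x i y] is [x] with entry [i] set to
   [y : 'rV_(gdim g i)]. *)
Definition own_cost (R : realType) (N m : nat) (g : game R N m) (i : 'I_N)
    (x : profile g) (y : 'rV[R]_(gdim g i)) : R :=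
  cost i (dfwith x i y).

Definition nash (R : realType) (N m : nat) (g : game R N m) (x : profile g) :
    Prop :=
  feasible x /\
  forall (i : 'I_N) (y : 'rV[R]_(gdim g i)),
    strat g i y -> own_cost x (x i) <= own_cost x y.

Definition pseudo_grad (R : realType) (N m : nat) (g : game R N m)
    (x : profile g) : profile g :=
  fun i => grad (own_cost (i := i) x) (x i).

Definition Gmap (R : realType) (N m : nat) (g : game R N m) (i : 'I_N)
    (u : 'rV[R]_(gdim g i)) (s : 'rV[R]_m) : 'rV[R]_(gdim g i) :=
  grad (fun u' => vtheta g i u' s) u
  + N%:R^-1 *: (grad (vtheta g i u) s *m ('J (phi g i) u)^T).

Definition Gall (R : realType) (N m : nat) (g : game R N m) (x : profile g)
    (eta : 'I_N -> 'rV[R]_m) : profile g :=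
  fun i => Gmap (x i) (eta i).

(* The standing requirement on [vtheta]: both partial gradients exist and the
   chain rule F(x) = G(x, 1_N (x) sigma(x)) holds.  It is implied by joint
   differentiability of every [vtheta g i]. *)
Definition partial_grads_chain_rule (R : realType) (N m : nat)
    (g : game R N m) : Prop :=
  (forall (i : 'I_N) (u : 'rV[R]_(gdim g i)) (s : 'rV[R]_m),
     differentiable (fun u' => vtheta g i u' s) u
     /\ differentiable (vtheta g i u) s) /\
  (forall (x : profile g) (i : 'I_N),
     pseudo_grad x i = Gall x (fun=> sigma x) i).

Definition strategies_convex_closed (R : realType) (N m : nat)
    (g : game R N m) : Prop :=
  forall i : 'I_N,
    [/\ strat g i !=set0, convex_set (strat g i) & closed (strat g i)].

Definition differentiable_game (R : realType) (N m : nat) (g : game R N m) :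
    Prop :=
  forall (i : 'I_N) (x : profile g),
    differentiable (own_cost (i := i) x) (x i)
    /\ differentiable (phi g i) (x i).

Definition strongly_monotone (R : realType) (N m : nat) (g : game R N m)
    (mu : R) : Prop :=
  forall x y : profile g, feasible x -> feasible y ->
    mu * enorm (stack x - stack y) ^+ 2
    <= dotv (stack x - stack y) (stack (pseudo_grad x) - stack (pseudo_grad y)).

Definition lipschitz_game (R : realType) (N m : nat) (g : game R N m)
    (kappa1 kappa2 kappa3 : R) : Prop :=
  [/\ forall (eta : 'I_N -> 'rV[R]_m) (x y : profile g),
        feasible x -> feasible y ->
        enorm (stack (Gall x eta) - stack (Gall y eta))
        <= kappa1 * enorm (stack x - stack y),
      forall (x : profile g) (eta zeta : 'I_N -> 'rV[R]_m), feasible x ->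
        enorm (stack (Gall x eta) - stack (Gall x zeta))
        <= kappa2 * enorm (stack eta - stack zeta)
    & forall (i : 'I_N) (u v : 'rV[R]_(gdim g i)),
        strat g i u -> strat g i v ->
        enorm (phi g i u - phi g i v) <= kappa3 * enorm (u - v)].

(* [e j i] means that (j, i) is an edge, i.e. agent i receives information
   from agent j. *)
Definition is_adjacency (R : realType) (N : nat) (e : rel 'I_N)
    (A : 'M[R]_N) : Prop :=
  forall i j : 'I_N, if e j i then 0 < A i j else A i j == 0.

Definition strongly_connected (N : nat) (e : rel 'I_N) : Prop :=
  forall i j : 'I_N, connect e i j.

Definition d_in (R : realType) (N : nat) (A : 'M[R]_N) (i : 'I_N) : R :=
  \sum_(j < N) A i j.

Definition d_out (R : realType) (N : nat) (A : 'M[R]_N) (i : 'I_N) : R :=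
  \sum_(j < N) A j i.

Definition weight_balanced (R : realType) (N : nat) (A : 'M[R]_N) : Prop :=
  forall i : 'I_N, d_in A i = d_out A i.

Definition laplacian (R : realType) (N : nat) (A : 'M[R]_N) : 'M[R]_N :=
  diag_mx (\row_(i < N) d_in A i) - A.

Definition smallest_pos_eigenvalue (R : realType) (N : nat) (M : 'M[R]_N)
    (l : R) : Prop :=
  [/\ 0 < l, eigenvalue M l
    & forall l' : R, 0 < l' -> eigenvalue M l' -> l <= l'].

(* A solution on [0, +oo[ is continuous on [0, +oo[ and satisfies the
   equations at every t > 0.  Values at negative times are irrelevant, so no
   two-sided derivative is required at 0. *)
Definition solution (R : realType) (N m : nat) (g : game R N m)
    (A : 'M[R]_N) (alpha beta : R) (x : R -> profile g)
    (theta : R -> 'I_N -> 'rV[R]_m) : Prop :=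
  let eta t i := theta t i + phi g i (x t i) in
  forall i : 'I_N,
  [/\ strat g i (x 0 i),
      theta 0 i = 0,
      {within `[0, +oo[, continuous (fun t => x t i)},
      {within `[0, +oo[, continuous (fun t => theta t i)}
    & forall t : R, 0 < t ->
      is_derive t 1 (fun s => x s i)
        (eproj (strat g i) (x t i - alpha *: Gmap (x t i) (eta t i)) - x t i)
      /\ is_derive t 1 (fun s => theta s i)
        (beta *: \sum_(j < N) A i j *: (eta t j - eta t i))].

(* Main.v *)
Require Import Defs.
From mathcomp Require Import all_boot all_order all_algebra.
From mathcomp Require Import all_classical all_reals all_analysis.
From mathcomp Require Import ring lra.
Import Order.TTheory GRing.Theory Num.Theory.
Import numFieldNormedType.Exports.

Set Implicit Arguments.
Unset Strict Implicit.
Unset Printing Implicit Defensive.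

Local Open Scope classical_set_scope.
Local Open Scope ring_scope.

(** The proof is a Lyapunov argument coupling two quantities along a solution:
    the distance [a = |x - x*|] to the equilibrium and the norm [b] of the
    disagreement, the stacked vector of the errors [eta_i - sigma x] of the
    local estimates of the aggregate.

    The equilibrium is the fixed point of the projected gradient step.  The
    projection does not expand distances, and strong monotonicity with the
    Lipschitz bound makes the exact step a contraction by
    [q = sqrt (1 - 2 alpha mu + alpha^2 kappa^2)] on feasible profiles.  The
    algorithm uses [eta_i] in place of the aggregate, which costs at most
    [alpha kappa2 b] ([target_dist]).  Since the velocity is the target minus
    the position, [a] decays at rate [1 - q] up to this error.

    By weight balance the [theta_i] always sum to zero, so the disagreements sum
    to zero ([sum_disagreement_eq0]).  On such vectors the consensus term
    dissipates at least [beta lambda2 b^2] ([laplacian_spectral_gap], proved by minimising the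
    Rayleigh quotient), while the estimates are driven by the motion of
    [phi_i (x_i)], whose speed is at most [kappa3] times that of [x]
    ([phi_speed]).

    For that last bound, and for monotonicity, solutions must remain feasible.
    The target need not depend continuously on time, so this is obtained from
    supporting hyperplanes ([viability]) rather than from an integral formula.

    With a suitable weight [c], the derivative of [c a^2 + b^2] is at most
    minus twice a quadratic form in [(a, b)] ([lyapunov_rate]), which the step-size
    conditions make positive definite ([step_size_conditions]).  Hence
    [c a^2 + b^2] decays exponentially ([gronwall_decay]). *)

(** * Euclidean geometry of row vectors *)

Section Euclid.
Context {R : realType} {n : nat}.
Implicit Types u v w p z : 'rV[R]_n.

Lemma dotvC u v : dotv u v = dotv v u.
Proof. by apply: eq_bigr => j _; rewrite mulrC. Qed.

Lemma dotvDl u v w : dotv (u + v) w = dotv u w + dotv v w.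
Proof. by rewrite -big_split; apply: eq_bigr => j _; rewrite mxE mulrDl. Qed.

Lemma dotvZl (a : R) u v : dotv (a *: u) v = a * dotv u v.
Proof. by rewrite [RHS]mulr_sumr; apply: eq_bigr => j _; rewrite mxE mulrA. Qed.

Lemma dotvDr u v w : dotv u (v + w) = dotv u v + dotv u w.
Proof. by rewrite dotvC dotvDl !(dotvC u). Qed.

Lemma dotvZr (a : R) u v : dotv u (a *: v) = a * dotv u v.
Proof. by rewrite dotvC dotvZl dotvC. Qed.

Lemma dotvNl u v : dotv (- u) v = - dotv u v.
Proof. by rewrite -scaleN1r dotvZl mulN1r. Qed.

Lemma dotvNr u v : dotv u (- v) = - dotv u v.
Proof. by rewrite dotvC dotvNl dotvC. Qed.

Lemma dotvBl u v w : dotv (u - v) w = dotv u w - dotv v w.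
Proof. by rewrite dotvDl dotvNl. Qed.

Lemma dotvBr u v w : dotv u (v - w) = dotv u v - dotv u w.
Proof. by rewrite dotvDr dotvNr. Qed.

Lemma dot0v u : dotv 0 u = 0.
Proof. by rewrite -(scale0r 0) dotvZl mul0r. Qed.

Lemma dotv_sumr (I : finType) u (F : I -> 'rV[R]_n) :
  dotv u (\sum_i F i) = \sum_i dotv u (F i).
Proof.
by elim/big_rec2: _ => [|i x y _ <-]; [rewrite dotvC dot0v|rewrite dotvDr].
Qed.

Lemma dotvv_ge0 u : 0 <= dotv u u.
Proof. by apply: sumr_ge0 => j _; rewrite -expr2 sqr_ge0. Qed.

Lemma dotvv_eq0 u : dotv u u = 0 -> u = 0.
Proof.
move=> /eqP; rewrite psumr_eq0 => [/allP u0|j _]; last by rewrite -expr2 sqr_ge0.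
apply/rowP => j; rewrite mxE; apply/eqP; rewrite -sqrf_eq0 expr2.
by apply: u0; rewrite mem_index_enum.
Qed.

Lemma enorm_ge0 u : 0 <= enorm u.
Proof. exact: sqrtr_ge0. Qed.

Lemma sqr_enorm u : enorm u ^+ 2 = dotv u u.
Proof. by rewrite sqr_sqrtr// dotvv_ge0. Qed.

Lemma enorm_eq0 u : enorm u = 0 -> u = 0.
Proof. by move=> u0; apply: dotvv_eq0; rewrite -sqr_enorm u0 expr0n. Qed.

(** Weighing [u] and [v] by the squared length and the inner product makes the
    nonnegative number [|<v,v> u - <u,v> v|^2] a multiple of the Gram
    determinant. *)
Lemma dotv_cauchy_schwarz u v : dotv u v <= enorm u * enorm v.
Proof.
have [uv0|uv0] := leP (dotv u v) 0.
  by rewrite (le_trans uv0)// mulr_ge0// enorm_ge0.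
rewrite -(@ler_pXn2r _ 2)// ?nnegrE ?(ltW uv0) ?mulr_ge0 ?enorm_ge0//.
rewrite exprMn !sqr_enorm.
have v0 : 0 < dotv v v.
  rewrite lt_neqAle dotvv_ge0 andbT eq_sym; apply/eqP => /dotvv_eq0 v0.
  by move: uv0; rewrite v0 dotvC dot0v ltxx.
have := dotvv_ge0 (dotv v v *: u - dotv u v *: v).
rewrite dotvBl !dotvBr !dotvZl !dotvZr (dotvC v u) => H.
have : 0 <= dotv v v * (dotv u u * dotv v v - dotv u v ^+ 2).
  by apply: le_trans H _; rewrite le_eqVlt; apply/orP; left; apply/eqP; ring.
by rewrite pmulr_rge0// subr_ge0.
Qed.

Lemma ler_enorm u v : (enorm u <= enorm v) = (dotv u u <= dotv v v).
Proof. by rewrite ler_sqrt// dotvv_ge0. Qed.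

Lemma ler_enorm_sqr u (a : R) : 0 <= a -> dotv u u <= a ^+ 2 -> enorm u <= a.
Proof.
move=> a0; rewrite -sqr_enorm ler_pXn2r ?nnegrE ?enorm_ge0//.
Qed.

Lemma ler_enormD u v : enorm (u + v) <= enorm u + enorm v.
Proof.
apply: ler_enorm_sqr; first by rewrite addr_ge0 ?enorm_ge0.
rewrite dotvDl !dotvDr (dotvC v u) -!sqr_enorm.
have := dotv_cauchy_schwarz u v; lra.
Qed.

Lemma enormZ (a : R) u : 0 <= a -> enorm (a *: u) = a * enorm u.
Proof.
move=> a0; rewrite /enorm dotvZl dotvZr mulrA -expr2 sqrtrM ?sqr_ge0//.
by rewrite sqrtr_sqr ger0_norm.
Qed.

Lemma enormBC u v : enorm (u - v) = enorm (v - u).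
Proof. by rewrite /enorm -(opprB v u) dotvNl dotvNr opprK. Qed.

(** The variational inequality [<z - p, w - p> <= 0] for all [w] of the set
    characterises [p] as the projection of [z]; two such inequalities, tested
    on each other's solution, give that projections do not expand distances. *)
Lemma projection_nonexpansive z1 z2 p1 p2 :
  dotv (z1 - p1) (p2 - p1) <= 0 -> dotv (z2 - p2) (p1 - p2) <= 0 ->
  enorm (p1 - p2) <= enorm (z1 - z2).
Proof.
move=> h1 h2.
have H : enorm (p1 - p2) ^+ 2 <= enorm (z1 - z2) * enorm (p1 - p2).
  apply: le_trans (dotv_cauchy_schwarz (z1 - z2) (p1 - p2)).
  rewrite sqr_enorm; move: h1 h2.
  by rewrite !dotvBl !dotvBr (dotvC p2 p1); lra.
have [->|p0] := eqVneq (enorm (p1 - p2)) 0; first exact: enorm_ge0.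
have p1p2_gt0 : 0 < enorm (p1 - p2) by rewrite lt_neqAle eq_sym p0 enorm_ge0.
by move: H; rewrite expr2 ler_pM2r.
Qed.

End Euclid.

Section Stack.
Context {R : realType} {N : nat} {n : 'I_N -> nat}.
Implicit Types x y : forall i, 'rV[R]_(n i).

Lemma dotv_stack x y : dotv (stack x) (stack y) = \sum_i dotv (x i) (y i).
Proof.
have dotvE k (u v : 'rV[R]_k) : dotv u v = (u *m v^T) 0 0.
  by rewrite mxE; apply: eq_bigr => j _; rewrite mxE.
rewrite dotvE /stack tr_mxrow mul_mxrow_mxcol summxE.
by apply: eq_bigr => i _; rewrite dotvE.
Qed.

Lemma stackB x y : stack x - stack y = stack (fun i => x i - y i).
Proof. by rewrite /stack -mxrowB. Qed.

Lemma stackZ (a : R) x : a *: stack x = stack (fun i => a *: x i).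
Proof.
rewrite -mul_scalar_mx /stack mul_mxrow; apply: eq_mxrow => i.
by rewrite mul_scalar_mx.
Qed.

End Stack.

Lemma ler_enorm_stack (R : realType) (N : nat) (n n' : 'I_N -> nat) (k : R)
    (x : forall i, 'rV[R]_(n i)) (y : forall i, 'rV[R]_(n' i)) : 0 <= k ->
  (forall i, enorm (x i) <= k * enorm (y i)) ->
  enorm (stack x) <= k * enorm (stack y).
Proof.
move=> k0 xy; apply: ler_enorm_sqr; first by rewrite mulr_ge0 ?enorm_ge0.
rewrite exprMn sqr_enorm !dotv_stack mulr_sumr; apply: ler_sum => i _.
rewrite -!sqr_enorm -exprMn ler_pXn2r ?nnegrE ?mulr_ge0 ?enorm_ge0//.
Qed.

(** * Projections onto closed convex sets *)

Lemma cvg_sum_seq (R : realType) (V : normedModType R) (T : Type)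
    (F : set_system T) {FF : Filter F} (I : Type) (r : seq I)
    (f : I -> T -> V) (a : I -> V) :
  (forall i, f i t @[t --> F] --> a i) ->
  (\sum_(i <- r) f i t) @[t --> F] --> \sum_(i <- r) a i.
Proof.
move=> fa; elim: r => [|i r IH].
  by rewrite big_nil; under eq_fun do rewrite big_nil; exact: cvg_cst.
by rewrite big_cons; under eq_fun do rewrite big_cons; exact: cvgD.
Qed.

Lemma cvg_dotv (R : realType) (T : Type) (F : set_system T) {FF : Filter F}
    (n : nat) (f g : T -> 'rV[R]_n) (a b : 'rV[R]_n) :
  f t @[t --> F] --> a -> g t @[t --> F] --> b ->
  dotv (f t) (g t) @[t --> F] --> dotv a b.
Proof.
move=> fa gb; apply: cvg_sum_seq => j; apply: cvgM.
  exact: (cvg_comp _ _ fa (@coord_continuous _ _ _ 0 j a)).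
exact: (cvg_comp _ _ gb (@coord_continuous _ _ _ 0 j b)).
Qed.

Lemma continuous_sqr_dist (R : realType) (n : nat) (z : 'rV[R]_n) :
  continuous (fun v : 'rV[R]_n => dotv (z - v) (z - v)).
Proof.
move=> v; have zv : z - u @[u --> v] --> z - v.
  by apply: (@cvgB R _ _ (nbhs v) _ (cst z) id) => //; apply: cvg_cst.
by apply: (@cvg_dotv R _ (nbhs v) _ n (fun u => z - u) (fun u => z - u)).
Qed.

Lemma ler_mx_norm_enorm (R : realType) (n : nat) (u : 'rV[R]_n) :
  `|u| <= enorm u.
Proof.
rewrite /Num.Def.normr/= mx_normrE; apply: bigmax_le => [|[i j] _ /=].
  exact: enorm_ge0.
rewrite ord1 -(@ler_pXn2r _ 2)// ?nnegrE ?enorm_ge0//.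
rewrite real_normK ?num_real// sqr_enorm /dotv (bigD1 j)//= -expr2 lerDl.
by apply: sumr_ge0 => k _; rewrite -expr2 sqr_ge0.
Qed.

Lemma closed_le_continuous (R : realType) (T : topologicalType) (f : T -> R)
    (a : R) : continuous f -> closed [set v | f v <= a].
Proof.
by move=> fc; apply: (@preimage_closed _ _ f [set x : R | x <= a]) => [v _|];
  [exact: fc|exact: closed_le].
Qed.

(** Only the part of [C] that is no farther from [z] than one chosen point of
    [C] matters; that part is compact. *)
Lemma closest_point_exists (R : realType) (n : nat) (C : set 'rV[R]_n)
    (z : 'rV[R]_n) : C !=set0 -> closed C ->
  exists2 p, C p & forall w, C w -> enorm (z - p) <= enorm (z - w).
Proof.
move=> [c0 Cc0] Ccl; pose f (v : 'rV[R]_n) := dotv (z - v) (z - v).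
pose K := C `&` [set v | f v <= f c0].
have bnd (v : 'rV[R]_n) : f v <= f c0 -> `|v| <= `|z| + enorm (z - c0).
  move=> fv; have := ler_normB z (z - v); rewrite subKr => /le_trans; apply.
  rewrite lerD2l; have := ler_mx_norm_enorm (z - v) => /le_trans; apply.
  by apply: ler_enorm_sqr; rewrite ?enorm_ge0// sqr_enorm.
have Kbnd : bounded_set K.
  exists (`|z| + enorm (z - c0)); split; first by rewrite num_real.
  by move=> r hr v [_ /= fv]; apply: (le_trans (bnd v fv)); exact: ltW.
have Kcl : closed K.
  apply: closedI => //; apply: closed_le_continuous.
  exact: continuous_sqr_dist.
have K0 : K !=set0 by exists c0; split => /=.
have [|p pK pmin] := EVT_min_rV K0 (bounded_closed_compact Kbnd Kcl) (f := f).
  by apply: continuous_subspaceT; exact: continuous_sqr_dist.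
move: pK; rewrite inE => -[Cp fp]; exists p => // w Cw.
rewrite ler_enorm; have [fw|/ltW fw] := leP (f w) (f c0); last first.
  exact: le_trans fw.
by apply: pmin; rewrite inE.
Qed.

(** How a first-order condition follows from minimality along a segment: a
    linear term dominated by a quadratic one near [0] cannot be positive. *)
Lemma ler0_of_small_quadratic (R : realFieldType) (a b : R) :
  (forall s, 0 < s -> s <= 1 -> s * a <= s ^+ 2 * b) -> a <= 0.
Proof.
move=> h; rewrite leNgt; apply/negP => a0.
pose c := a + `|b| + 1.
have c0 : 0 < c by rewrite /c -addrA addr_gt0// ltr_wpDl.
have ac : a / c <= 1.
  by rewrite ler_pdivrMr// mul1r /c -addrA lerDl addr_ge0.
(* at s = a / (a + |b| + 1) the quadratic term is strictly smaller *)
have := h (a / c) (divr_gt0 a0 c0) ac.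
rewrite expr2 -mulrA ler_pM2l ?divr_gt0// => hb.
have : a / c * b < a.
  rewrite mulrAC -mulrA -[X in _ < X]mulr1 ltr_pM2l// ltr_pdivrMr// mul1r.
  by rewrite (le_lt_trans (ler_norm b))// /c addrAC ltrDr addr_gt0.
by rewrite ltNge hb.
Qed.

Lemma convex_set_segment (R : realType) (n : nat) (C : set 'rV[R]_n)
    (p w : 'rV[R]_n) (s : R) : convex_set C -> C p -> C w ->
  0 <= s -> s <= 1 -> C (p + s *: (w - p)).
Proof.
move=> Cc Cp Cw s0 s1.
have := Cc w p (Itv01 s0 s1); rewrite !inE => /(_ Cw Cp).
congr (C _); apply/rowP => j; rewrite !mxE/= /unstable.onem; ring.
Qed.

(** Moving from the closest point [p] towards a point [w] of the convex set
    cannot decrease the distance to [z]; to first order this says that [z - p]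
    and [w - p] make an obtuse angle. *)
Lemma eprojP (R : realType) (n : nat) (C : set 'rV[R]_n) (z : 'rV[R]_n) :
  C !=set0 -> convex_set C -> closed C ->
  C (eproj C z) /\
  forall w, C w -> dotv (z - eproj C z) (w - eproj C z) <= 0.
Proof.
move=> C0 Cc Ccl; have [p0 Cp0 p0min] := closest_point_exists z C0 Ccl.
have [Cp pmin] : [set y | C y /\ forall w, C w ->
    enorm (z - y) <= enorm (z - w)] (eproj C z).
  by apply: getPex; exists p0.
split => // w Cw; set p := eproj C z in Cp pmin *.
suff : 2 * dotv (z - p) (w - p) <= 0 by rewrite pmulr_rle0.
apply: (@ler0_of_small_quadratic _ _ (dotv (w - p) (w - p))) => s s0 s1.
have := pmin _ (convex_set_segment Cc Cp Cw (ltW s0) s1).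
rewrite ler_enorm opprD addrA.
rewrite (dotvBl (z - p)) !(dotvBr _ (z - p)) !dotvZl !dotvZr.
by rewrite (dotvC (w - p) (z - p)); lra.
Qed.

(** * First-order condition at an equilibrium *)

Lemma differential_grad (R : realType) (n : nat) (f : 'rV[R]_n -> R)
    (x v : 'rV[R]_n) : differentiable f x -> 'D_v f x = dotv v (grad f x).
Proof.
move=> fx; rewrite deriveE// {1}(row_sum_delta v) linear_sum.
by apply: eq_bigr => j _; rewrite linearZ mxE deriveE.
Qed.

(** A player's cost is minimal along the segment from [x i] to [w], so its
    one-sided directional derivative at [x i] is nonnegative. *)
Lemma nash_variational (R : realType) (N m : nat) (g : game R N m)
    (x : profile g) (i : 'I_N) (w : 'rV[R]_(gdim g i)) :
  convex_set (strat g i) ->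
  differentiable (own_cost (i := i) x) (x i) -> nash x -> strat g i w ->
  0 <= dotv (w - x i) (pseudo_grad x i).
Proof.
move=> Cc fx [xf xmin] Cw; rewrite -differential_grad//.
have fd : derivable (own_cost (i := i) x) (x i) (w - x i).
  by apply: diff_derivable.
rewrite /derive cvg_at_rightE//.
apply: limr_ge; first by apply: cvgP; exact: cvg_dnbhs_at_right fd.
near=> h => /=.
have h0 : 0 < h by near: h; exact: nbhs_right_gt.
apply: mulr_ge0; first by rewrite invr_ge0 ltW.
rewrite subr_ge0; apply: xmin.
rewrite addrC; apply: convex_set_segment; rewrite ?(ltW h0)//.
by near: h; apply: nbhs_right_le; exact: ltr01.
Unshelve. all: by end_near. Qed.

(** * Spectral gap of a weight-balanced digraph *)

Lemma dotv_mulmx (R : realType) (n : nat) (M : 'M[R]_n) (u v : 'rV[R]_n) :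
  dotv (u *m M) v = dotv u (v *m M^T).
Proof.
have dotvE (a b : 'rV[R]_n) : dotv a b = (a *m b^T) 0 0.
  by rewrite mxE; apply: eq_bigr => j _; rewrite mxE.
by rewrite !dotvE trmx_mul trmxK mulmxA.
Qed.

Lemma continuous_quadratic_form (R : realType) (n : nat) (M : 'M[R]_n) :
  continuous (fun v : 'rV[R]_n => dotv v (v *m M)).
Proof.
have ME u : dotv u (u *m M) = \sum_k u 0 k * dotv u (row k M).
  by rewrite mulmx_sum_row dotv_sumr; apply: eq_bigr => k _; rewrite dotvZr.
move=> v; rewrite /continuous_at ME; under eq_fun do rewrite ME.
apply: (@cvg_sum_seq R R _ (nbhs v) _ _ _ (fun k u => u 0 k * dotv u (row k M))).
move=> k; apply: (@cvgM R _ (nbhs v) _ (fun u => u 0 k)).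
  exact: coord_continuous.
by apply: (@cvg_dotv R _ (nbhs v) _ n id (cst (row k M))) => //; apply: cvg_cst.
Qed.

(** The minimum of the quadratic form over the unit sphere of the orthogonal
    complement of [u0] is attained by compactness.  At a minimiser [v0] with
    value [l] the residual [v0 S - l v0] stays orthogonal to [u0], and moving
    [v0] against it would decrease the form to first order unless the residual
    vanishes: so [v0] is an eigenvector. *)
Lemma rayleigh_minimum (R : realType) (n : nat) (S : 'M[R]_n)
    (u0 : 'rV[R]_n) : S^T = S -> u0 *m S = 0 ->
  (exists2 w : 'rV[R]_n, dotv w u0 = 0 & w != 0) ->
  exists l (v0 : 'rV[R]_n),
    [/\ dotv v0 u0 = 0, dotv v0 v0 = 1, v0 *m S = l *: v0 &
        forall w, dotv w u0 = 0 -> l * dotv w w <= dotv w (w *m S)].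
Proof.
move=> Ssym Su0 [w0 w0u0 w0n0].
pose K := [set v : 'rV[R]_n | dotv v u0 = 0] `&` [set v | dotv v v = 1].
have normalize (w : 'rV[R]_n) : dotv w u0 = 0 -> w != 0 ->
    K ((enorm w)^-1 *: w).
  move=> wu0 wn0; split => /=; first by rewrite dotvZl wu0 mulr0.
  have wn : enorm w != 0 by apply: contra_neq wn0; exact: enorm_eq0.
  by rewrite dotvZl dotvZr -sqr_enorm expr2 mulKf ?mulVf.
have idc : continuous (fun v : 'rV[R]_n => dotv v v).
  by move=> v; apply: (@cvg_dotv R _ (nbhs v) _ n id id).
have u0c : continuous (fun v : 'rV[R]_n => dotv v u0).
  move=> v; apply: (@cvg_dotv R _ (nbhs v) _ n id (cst u0)) => //.
  by apply: cvg_cst.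
have Kcl : closed K.
  apply: closedI.
    by apply: (@preimage_closed _ _ (fun v : 'rV[R]_n => dotv v u0)
      [set x : R | x = 0]) => [v _|]; [exact: u0c|exact: closed_eq].
  by apply: (@preimage_closed _ _ (fun v : 'rV[R]_n => dotv v v)
    [set x : R | x = 1]) => [v _|]; [exact: idc|exact: closed_eq].
have bnd (v : 'rV[R]_n) : dotv v v = 1 -> `|v| <= 1.
  move=> v1; apply: (le_trans (ler_mx_norm_enorm v)).
  by rewrite /enorm v1 sqrtr1.
have Kbnd : bounded_set K.
  exists 1; split; first by rewrite num_real.
  by move=> r r1 v [_ /= v1]; apply: (le_trans (bnd v v1)); exact: ltW.
have K0 : K !=set0 by exists ((enorm w0)^-1 *: w0); exact: normalize.
have [|v0 v0K v0min] := EVT_min_rV K0 (bounded_closed_compact Kbnd Kcl)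
    (f := fun v => dotv v (v *m S)).
  by apply: continuous_subspaceT; exact: continuous_quadratic_form.
move: v0K; rewrite inE => -[/= v0u0 v01].
pose l := dotv v0 (v0 *m S).
have lmin (w : 'rV[R]_n) : dotv w u0 = 0 -> l * dotv w w <= dotv w (w *m S).
  move=> wu0; have [->|wn0] := eqVneq w 0; first by rewrite !dot0v mulr0.
  have wn : 0 < enorm w.
    rewrite lt_neqAle enorm_ge0 andbT eq_sym.
    by apply: contra_neq wn0; exact: enorm_eq0.
  have := v0min ((enorm w)^-1 *: w); rewrite inE => /(_ (normalize _ wu0 wn0)).
  rewrite -scalemxAl dotvZl dotvZr mulrA -expr2 exprVn => h.
  by rewrite -sqr_enorm -ler_pdivlMr ?exprn_gt0// mulrC.
exists l, v0; split => //.
pose r := v0 *m S - l *: v0.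
have ru0 : dotv r u0 = 0.
  by rewrite dotvBl dotvZl v0u0 dotv_mulmx Ssym Su0 dotvC dot0v mulr0 subrr.
have rE : v0 *m S = r + l *: v0 by rewrite /r subrK.
apply/eqP; rewrite -subr_eq0; apply/eqP; apply: dotvv_eq0; apply/eqP.
rewrite -/r; clearbody r; rewrite eq_le dotvv_ge0 andbT.
suff : 2 * dotv r r <= 0 by rewrite pmulr_rle0.
apply: (@ler0_of_small_quadratic _ _ (dotv r (r *m S) - l * dotv r r)).
move=> s _ _.
have := lmin (v0 - s *: r); rewrite dotvBl dotvZl v0u0 ru0 mulr0 subrr.
move=> /(_ erefl); rewrite mulmxBl -scalemxAl.
rewrite !dotvBl !dotvBr !dotvZl !dotvZr v01 -/l.
have -> : dotv v0 (r *m S) = dotv r (v0 *m S).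
  by rewrite dotvC dotv_mulmx Ssym.
rewrite rE !dotvDr !dotvZr (dotvC v0 r).
by lra.
Qed.

Section Laplacian.
Context {R : realType} {N : nat} (A : 'M[R]_N) (Abal : weight_balanced A).
Implicit Types v : 'rV[R]_N.

Let S := 2^-1 *: (laplacian A + (laplacian A)^T).

Lemma mulmx_tr_laplacian v i :
  (v *m (laplacian A)^T) 0 i = \sum_j A i j * (v 0 i - v 0 j).
Proof.
rewrite /laplacian linearB/= tr_diag_mx mulmxBr mxE mul_mx_diag !mxE.
rewrite mulr_sumr -sumrN -big_split; apply: eq_bigr => j _.
by rewrite mxE mulrBr mulrC (mulrC (v 0 j)).
Qed.

Lemma const_mul_sym_laplacian : (const_mx 1 : 'rV[R]_N) *m S = 0.
Proof.
rewrite /S -scalemxAr mulmxDr; apply/rowP => i; rewrite mxE [X in _ * X]mxE.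
rewrite mulmx_tr_laplacian big1 => [|j _]; last by rewrite !mxE subrr mulr0.
rewrite addr0 /laplacian mulmxBr mxE mul_mx_diag !mxE mul1r Abal.
rewrite /d_out -sumrN -big_split big1 ?mulr0// => j _.
by rewrite /= mxE mul1r subrr.
Qed.

Lemma sym_laplacian_form v :
  dotv v (v *m S) = \sum_i v 0 i * \sum_j A i j * (v 0 i - v 0 j).
Proof.
have -> : dotv v (v *m S) = dotv v (v *m (laplacian A)^T).
  rewrite /S -scalemxAr mulmxDr dotvZr dotvDr (dotvC v (v *m laplacian A)).
  by rewrite dotv_mulmx; field.
by apply: eq_bigr => i _; rewrite mulmx_tr_laplacian.
Qed.

Lemma balanced_dirichlet_form v :
  \sum_i v 0 i * \sum_j A i j * (v 0 i - v 0 j)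
  = 2^-1 * \sum_i \sum_j A i j * (v 0 i - v 0 j) ^+ 2.
Proof.
have E : \sum_i \sum_j A i j * v 0 i ^+ 2 = \sum_i \sum_j A i j * v 0 j ^+ 2.
  rewrite [RHS]exchange_big; apply: eq_bigr => i _.
  by rewrite -!mulr_suml; congr (_ * _); exact: Abal.
have -> : \sum_i v 0 i * \sum_j A i j * (v 0 i - v 0 j) =
    \sum_i \sum_j (A i j * v 0 i ^+ 2) - \sum_i \sum_j A i j * v 0 i * v 0 j.
  rewrite -sumrB; apply: eq_bigr => i _; rewrite mulr_sumr -sumrB.
  by apply: eq_bigr => j _; ring.
have -> : \sum_i \sum_j A i j * (v 0 i - v 0 j) ^+ 2 =
    \sum_i \sum_j (A i j * v 0 i ^+ 2) + \sum_i \sum_j (A i j * v 0 j ^+ 2)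
    - 2 * \sum_i \sum_j A i j * v 0 i * v 0 j.
  rewrite mulr_sumr -big_split -sumrB; apply: eq_bigr => i _ /=.
  rewrite mulr_sumr -big_split -sumrB; apply: eq_bigr => j _ /=; ring.
by rewrite -E; field.
Qed.

(** The smallest value of the form on the unit sphere orthogonal to the
    constants is an eigenvalue.  It is positive because the form is a weighted
    sum of squared differences along edges: a zero of it is constant on a
    strongly connected graph, hence zero when its entries sum to zero.  So
    [lambda2] is at most that smallest value. *)
Lemma laplacian_spectral_gap (e : rel 'I_N) (lambda2 : R) v :
  is_adjacency e A -> strongly_connected e ->
  smallest_pos_eigenvalue S lambda2 -> \sum_i v 0 i = 0 ->
  lambda2 * dotv v v <= \sum_i v 0 i * \sum_j A i j * (v 0 i - v 0 j).
Proof.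
move=> Ae ec [_ _ l2min] v0.
have dot1 (w : 'rV[R]_N) : dotv w (const_mx 1) = \sum_i w 0 i.
  by apply: eq_bigr => i _; rewrite mxE mulr1.
rewrite -sym_laplacian_form.
have [->|vn0] := eqVneq v 0; first by rewrite !dot0v mulr0.
have Ssym : S^T = S by rewrite /S linearZ/= linearD/= trmxK addrC.
have [|l [w [w1 ww wS lmin]]] := rayleigh_minimum Ssym const_mul_sym_laplacian.
  by exists v; rewrite ?dot1.
have A_ge0 i j : 0 <= A i j.
  by have := Ae i j; case: (e j i) => [/ltW//|/eqP->].
have wn0 : w != 0.
  by apply/eqP => w0; move: ww; rewrite w0 dot0v => /eqP; rewrite eq_sym oner_eq0.
suff l0 : 0 < l.
  apply: le_trans (lmin v _); last by rewrite dot1.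
  rewrite ler_wpM2r ?dotvv_ge0//; apply: l2min => //.
  by apply/eigenvalueP; exists w.
have lE : l = 2^-1 * \sum_i \sum_j A i j * (w 0 i - w 0 j) ^+ 2.
  rewrite -balanced_dirichlet_form -sym_laplacian_form wS dotvZr ww.
  by rewrite mulr1.
have term_ge0 i j : 0 <= A i j * (w 0 i - w 0 j) ^+ 2.
  by rewrite mulr_ge0 ?sqr_ge0.
rewrite lt_neqAle; apply/andP; split; last first.
  by rewrite lE mulr_ge0// sumr_ge0// => i _; rewrite sumr_ge0.
apply: contraNneq wn0 => l0.
have edge i j : e j i -> w 0 i = w 0 j.
  move=> eji; have := Ae i j; rewrite eji => Aij.
  have := l0; rewrite lE => /esym/eqP; rewrite mulf_eq0 invr_eq0 pnatr_eq0/=.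
  rewrite psumr_eq0 => [/allP/(_ i (mem_index_enum _))/=|k _]; last first.
    by rewrite sumr_ge0.
  rewrite psumr_eq0 => [/allP/(_ j (mem_index_enum _))/=|k _]; last by [].
  by rewrite mulf_eq0 gt_eqF//= sqrf_eq0 subr_eq0 => /eqP.
have wconst i j : w 0 i = w 0 j.
  have /connectP[p] := ec i j.
  elim: p i => [i _ /= ->//|k p IH i /= /andP[eik pk] jl].
  by rewrite -(IH k)// (edge _ _ eik).
apply/eqP/rowP => i; rewrite mxE; apply/eqP.
have : \sum_j w 0 j = 0 by rewrite -dot1.
under eq_bigr do rewrite (wconst _ i).
rewrite sumr_const card_ord => /eqP; rewrite mulrn_eq0 => /orP[N0|//].
by have := leq_ltn_trans (leq0n i) (ltn_ord i); rewrite lt0n N0.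
Qed.

End Laplacian.

(** * Differential inequalities along a trajectory *)

(** The derivative of [expR (k * t) * f t] is nonpositive. *)
Lemma gronwall_decay (R : realType) (k : R) (f : R -> R) :
  {within `[0, +oo[, continuous f} ->
  (forall t : R, 0 < t -> exists2 df, is_derive t 1 f df & df <= - k * f t) ->
  forall t, 0 <= t -> f t <= f 0 * expR (- k * t).
Proof.
move=> fc fd t; rewrite le_eqVlt => /predU1P[<-|t0].
  by rewrite mulr0 expR0 mulr1.
pose W s := expR (k * s) * f s.
have Ed (s : R) : is_derive s 1 (fun s : R => expR (k * s)) (expR (k * s) * k).
  have kd : is_derive s 1 (fun s : R => k * s) k.
    exact: (is_derive_eq (is_deriveZ k (is_derive_id s 1)) (mulr1 k)).
  exact: (is_derive1_comp (is_derive_expR _) kd).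
have Wd (s : R) : 0 < s -> exists2 dW, is_derive s 1 W dW & dW <= 0.
  move=> s0; have [df dfd dfle] := fd s s0.
  have WD := is_deriveM (Ed s) dfd.
  exists (expR (k * s) *: df + f s *: (expR (k * s) * k)) => //.
  rewrite /GRing.scale/= mulrCA -mulrDr pmulr_rle0 ?expR_gt0//.
  by rewrite -lerBrDr sub0r mulrC -mulNr.
have Ec : continuous (fun s : R => expR (k * s)).
  move=> s; apply: differentiable_continuous; apply/derivable1_diffP.
  by case: (Ed s).
have Wc : {within `[0, t], continuous W}.
  have fct : {within `[0, t], continuous f}.
    apply: continuous_subspaceW fc => s /=; rewrite !in_itv/= andbT.
    by case/andP.
  move=> s; apply: (@continuousM _ (subspace `[0, t]) (fun s : R => expR (k * s)) f).
    exact: continuous_subspaceT.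
  exact: fct.
have : W t <= W 0.
  apply: (ler0_derive1_le_cc _ _ Wc); rewrite ?in_itv/= ?lexx ?(ltW t0)//.
    by move=> s; rewrite in_itv/= => /andP[/Wd[dW []]].
  move=> s; rewrite in_itv/= => /andP[/Wd[dW dWd dW0] _].
  by rewrite derive1E derive_val.
rewrite /W mulr0 expR0 mul1r -ler_pdivlMl ?expR_gt0// => /le_trans; apply.
by rewrite mulrC mulNr expRN.
Qed.

Section Calculus.
Context {R : realType}.

Lemma is_derive_coord (n : nat) (u : R -> 'rV[R]_n) (t : R) (du : 'rV[R]_n)
    (j : 'I_n) :
  is_derive t 1 u du -> is_derive t 1 (fun s => u s 0 j) (du 0 j).
Proof.
move=> [ud uE]; split; first by have /derivable_mxP := ud; apply.
by rewrite -uE derive_mx// mxE.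
Qed.

Lemma is_derive_dotv (n : nat) (u v : R -> 'rV[R]_n) (t : R)
    (du dv : 'rV[R]_n) :
  is_derive t 1 u du -> is_derive t 1 v dv ->
  is_derive t 1 (fun s => dotv (u s) (v s)) (dotv (u t) dv + dotv (v t) du).
Proof.
move=> ud vd; rewrite /dotv -big_split/=.
have -> : (fun s => \sum_(j < n) u s 0 j * v s 0 j) =
    \sum_(j < n) ((fun s => u s 0 j) * (fun s => v s 0 j)).
  by apply/funext => s; rewrite fct_sumE.
by apply: is_derive_sum => j; apply: is_deriveM; exact: is_derive_coord.
Qed.

Lemma within_continuous_dotv (n : nat) (D : set R) (u v : R -> 'rV[R]_n) :
  {within D, continuous u} -> {within D, continuous v} ->
  {within D, continuous (fun s => dotv (u s) (v s))}.
Proof. by move=> uc vc t; apply: cvg_dotv; [exact: uc|exact: vc]. Qed.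

Lemma is_derive_dotvv (n : nat) (u : R -> 'rV[R]_n) (t : R) (du : 'rV[R]_n) :
  is_derive t 1 u du ->
  is_derive t 1 (fun s => dotv (u s) (u s)) (2 * dotv (u t) du).
Proof.
by move=> ud; apply: is_derive_eq (is_derive_dotv ud ud) _; rewrite mulr_natl.
Qed.

(** If [x t] left [C], let [z] be its projection and [nu := x t - z].  The
    signed height [<nu, x s - z>] over the supporting hyperplane at [z] starts
    nonpositive, and since the target of the flow stays in [C] its derivative
    is at most minus itself; so it cannot reach the value [|nu|^2 > 0]. *)
Lemma viability (n : nat) (C : set 'rV[R]_n) (x p : R -> 'rV[R]_n) :
  convex_set C -> closed C -> C (x 0) -> {within `[0, +oo[, continuous x} ->
  (forall t : R, 0 < t -> C (p t) /\ is_derive t 1 x (p t - x t)) ->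
  forall t, 0 <= t -> C (x t).
Proof.
move=> Cc Ccl Cx0 xc xd t t0.
have C0 : C !=set0 by exists (x 0).
have [Cz zP] := eprojP (x t) C0 Cc Ccl.
set z := eproj C (x t) in Cz zP; pose nu := x t - z.
pose f s := dotv nu (x s - z).
have f0 : f 0 <= 0 by exact: zP.
have fd (s : R) : 0 < s -> exists2 df, is_derive s 1 f df & df <= - 1 * f s.
  move=> s0; have [Cp xds] := xd s s0.
  have xzd : is_derive s 1 (fun s => x s - z) (p s - x s).
    by apply: (is_derive_eq (is_deriveB xds (is_derive_cst z s 1)));
      rewrite subr0.
  have fds := is_derive_dotv (is_derive_cst nu s 1) xzd.
  eexists; first exact: fds.
  rewrite /= [dotv _ 0]dotvC dot0v addr0 mulN1r /f -dotvNr -subr_le0 -dotvBr.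
  by rewrite opprK addrA subrK; exact: zP.
have fc : {within `[0, +oo[, continuous f}.
  apply: within_continuous_dotv => s; first exact: cvg_cst.
  by apply: cvgB; [exact: xc|exact: cvg_cst].
have ft : dotv nu nu <= 0.
  apply: le_trans (gronwall_decay fc fd t0) _.
  by rewrite mulr_le0_ge0// expR_ge0.
have -> : x t = z.
  apply/eqP; rewrite -subr_eq0; apply/eqP/dotvv_eq0/eqP.
  by rewrite eq_le ft dotvv_ge0.
exact: Cz.
Qed.

Lemma constant_of_zero_derive (f : R -> R) :
  {within `[0, +oo[, continuous f} ->
  (forall t : R, 0 < t -> is_derive t 1 f 0) -> forall t, 0 <= t -> f t = f 0.
Proof.
suff H (h : R -> R) : {within `[0, +oo[, continuous h} ->
    (forall t : R, 0 < t -> is_derive t 1 h 0) -> forall t, 0 <= t -> h t <= h 0.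
  move=> fc fd t t0; apply/eqP; rewrite eq_le H//= -lerN2.
  apply: (H (- f)) => // [s|s s0]; first by apply: continuousN; exact: fc.
  by apply: (is_derive_eq (is_deriveN (fd s s0))); rewrite oppr0.
move=> hc hd t t0; have := @gronwall_decay R 0 h hc _ t t0.
rewrite oppr0 mul0r expR0 mulr1; apply => s s0.
by exists 0; [exact: hd|rewrite mul0r].
Qed.

(** The map [h] is Lipschitz only on [C], so its derivative need not be bounded
    in all directions; along a curve in [C] the difference quotients are. *)
Lemma derive_lipschitz_bound (n n' : nat) (C : set 'rV[R]_n)
    (h : 'rV[R]_n -> 'rV[R]_n') (k : R) (x : R -> 'rV[R]_n) (t : R)
    (dx : 'rV[R]_n) (dy : 'rV[R]_n') : 0 <= k ->
  (forall u v, C u -> C v -> enorm (h u - h v) <= k * enorm (u - v)) ->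
  (forall s, 0 <= s -> C (x s)) -> 0 < t -> is_derive t 1 x dx ->
  is_derive t 1 (fun s => h (x s)) dy -> enorm dy <= k * enorm dx.
Proof.
move=> k0 hL xC t0 [xd <-] [yd <-].
apply: ler_enorm_sqr; first by rewrite mulr_ge0 ?enorm_ge0.
rewrite exprMn sqr_enorm.
have xq := @cvg_dotv R R 0^' (dnbhs_filter 0) n _ _ _ _ xd xd.
have yq := @cvg_dotv R R 0^' (dnbhs_filter 0) n' _ _ _ _ yd yd.
apply: (ler_cvg_to yq (cvgM (cvg_cst (k ^+ 2)) xq)); near=> s => /=.
rewrite !dotvZl !dotvZr !(mulrA s^-1) -expr2 mulrCA ler_wpM2l ?sqr_ge0//.
rewrite -!sqr_enorm -exprMn ler_pXn2r ?nnegrE ?mulr_ge0 ?enorm_ge0//.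
apply: hL; apply: xC; rewrite ?(ltW t0)//.
have : `|s| < t by near: s; exact: dnbhs0_lt.
by rewrite ltr_norml => /andP[st _]; rewrite /GRing.scale/= mulr1; lra.
Unshelve. all: by end_near. Qed.

End Calculus.

(** * Estimates for the game *)

Lemma positive_definite_quadratic (R : realFieldType) (A B D c : R) :
  0 < A -> 0 < B -> 0 < c -> D ^+ 2 < A * B ->
  exists2 gamma, 0 < gamma &
    forall a b, gamma * (c * a ^+ 2 + b ^+ 2)
                <= A * a ^+ 2 - 2 * D * a * b + B * b ^+ 2.
Proof.
move=> A0 B0 c0 DAB.
(* determinant over trace bounds the least eigenvalue from below *)
pose g0 := (A * B - D ^+ 2) / (A + B).
have AB0 : 0 < A + B by exact: addr_gt0.
have g00 : 0 < g0 by rewrite divr_gt0// subr_gt0.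
have c10 : 0 < c + 1 by rewrite addr_gt0.
have H a b : g0 * (a ^+ 2 + b ^+ 2) <=
    A * a ^+ 2 - 2 * D * a * b + B * b ^+ 2.
  rewrite /g0 mulrAC ler_pdivrMr// -subr_ge0.
  have -> : (A * a ^+ 2 - 2 * D * a * b + B * b ^+ 2) * (A + B)
      - (A * B - D ^+ 2) * (a ^+ 2 + b ^+ 2)
      = (A * a - D * b) ^+ 2 + (B * b - D * a) ^+ 2 by ring.
  by rewrite addr_ge0 ?sqr_ge0.
exists (g0 / (c + 1)); first exact: divr_gt0.
move=> a b; apply: le_trans (H a b).
rewrite -mulrA ler_pM2l// mulrC ler_pdivrMr//.
have := sqr_ge0 a; have := mulr_ge0 (ltW c0) (sqr_ge0 b).
by have := sqr_ge0 b; lra.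
Qed.

(** Replacing every vector by the mean is an orthogonal projection: the lost
    squared length is the sum of the squared deviations from the mean. *)
Lemma enorm_stack_mean (R : realType) (N m : nat) (d : 'I_N -> 'rV[R]_m) :
  enorm (stack (fun _ : 'I_N => N%:R^-1 *: \sum_i d i)) <= enorm (stack d).
Proof.
case: N d => [|N] d; first by rewrite ler_enorm !dotv_stack !big_ord0.
set M := N.+1%:R^-1 *: _; rewrite ler_enorm !dotv_stack -subr_ge0.
have sumd : \sum_i d i = N.+1%:R *: M.
  by rewrite scalerA mulfV ?pnatr_eq0// scale1r.
clearbody M; suff -> : \sum_i dotv (d i) (d i) - \sum_(i < N.+1) dotv M M =
    \sum_i dotv (d i - M) (d i - M).
  by apply: sumr_ge0 => i _; exact: dotvv_ge0.
have E i : dotv (d i - M) (d i - M) =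
    dotv (d i) (d i) - 2 * dotv M (d i) + dotv M M.
  by rewrite dotvBl !dotvBr (dotvC (d i) M); ring.
under [RHS]eq_bigr do rewrite E.
rewrite big_split/= sumrB -mulr_sumr -(dotv_sumr M d) sumd dotvZr.
have -> : \sum_(i < N.+1) dotv M M = N.+1%:R * dotv M M.
  by rewrite sumr_const card_ord mulr_natl.
by ring.
Qed.

Lemma laplacian_gap_stack (R : realType) (N m : nat) (e : rel 'I_N)
    (A : 'M[R]_N) (lambda2 : R) (y : 'I_N -> 'rV[R]_m) :
  weight_balanced A -> is_adjacency e A -> strongly_connected e ->
  smallest_pos_eigenvalue (2^-1 *: (laplacian A + (laplacian A)^T)) lambda2 ->
  \sum_i y i = 0 ->
  \sum_i dotv (y i) (\sum_j A i j *: (y j - y i))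
  <= - (lambda2 * dotv (stack y) (stack y)).
Proof.
move=> Ab Ae ec l2 y0; rewrite lerNr dotv_stack.
pose v k : 'rV[R]_N := \row_i y i 0 k.
have -> : lambda2 * \sum_i dotv (y i) (y i) =
    \sum_k lambda2 * dotv (v k) (v k).
  rewrite -mulr_sumr exchange_big; congr (_ * _); apply: eq_bigr => i _.
  by apply: eq_bigr => k _; rewrite mxE.
have -> : - \sum_i dotv (y i) (\sum_j A i j *: (y j - y i)) =
    \sum_k \sum_i v k 0 i * \sum_j A i j * (v k 0 i - v k 0 j).
  rewrite [RHS]exchange_big/= -sumrN; apply: eq_bigr => i _.
  rewrite -dotvNr; apply: eq_bigr => k _.
  rewrite !mxE summxE -sumrN; congr (_ * _); apply: eq_bigr => j _.
  by rewrite !mxE; ring.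
apply: ler_sum => k _; apply: laplacian_spectral_gap => //.
by under eq_bigr do rewrite mxE; rewrite -summxE y0 mxE.
Qed.

Section GameEstimates.
Context {R : realType} {N m : nat} (g : game R N m) (kappa1 kappa2 kappa3 : R).
Context (k2 : 0 <= kappa2) (k3 : 0 <= kappa3).
Context (gchain : partial_grads_chain_rule g).
Context (glip : lipschitz_game g kappa1 kappa2 kappa3).

Lemma pseudo_gradE (x : profile g) :
  stack (pseudo_grad x) = stack (Gall x (fun=> sigma x)).
Proof. by apply: eq_mxrow => i; have [_ ->] := gchain. Qed.

(** The aggregate is the mean of [kappa3]-Lipschitz maps, so [N] copies of it
    vary at most by [kappa3]; the factor [N] does not appear because averaging
    does not increase the stacked norm. *)
Lemma pseudo_grad_lipschitz (x y : profile g) : feasible x -> feasible y ->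
  enorm (stack (pseudo_grad x) - stack (pseudo_grad y))
  <= (kappa1 + kappa2 * kappa3) * enorm (stack x - stack y).
Proof.
move=> xf yf; have [lx leta lphi] := glip; rewrite !pseudo_gradE.
rewrite -(subrKA (stack (Gall y (fun=> sigma x)))).
apply: le_trans (ler_enormD _ _) _; rewrite [leRHS]mulrDl.
apply: lerD; first exact: lx.
apply: le_trans (leta y (fun=> sigma x) (fun=> sigma y) yf) _.
rewrite -mulrA ler_wpM2l//.
have -> : stack (fun _ : 'I_N => sigma x) - stack (fun _ : 'I_N => sigma y) =
    stack (fun _ : 'I_N => N%:R^-1 *: \sum_i (phi g i (x i) - phi g i (y i))).
  by rewrite stackB; apply: eq_mxrow => i; rewrite -scalerBr sumrB.
apply: le_trans (enorm_stack_mean _) _.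
by rewrite stackB; apply: ler_enorm_stack => // i; exact: lphi.
Qed.

(** Expanding the square, strong monotonicity bounds the cross term and the
    Lipschitz bound the quadratic one. *)
Lemma gradient_step_sqr (mu alpha : R) (x y : profile g) : 0 <= alpha ->
  strongly_monotone g mu -> feasible x -> feasible y ->
  enorm ((stack x - alpha *: stack (pseudo_grad x))
         - (stack y - alpha *: stack (pseudo_grad y))) ^+ 2
  <= (1 - 2 * alpha * mu + alpha ^+ 2 * (kappa1 + kappa2 * kappa3) ^+ 2)
     * enorm (stack x - stack y) ^+ 2.
Proof.
move=> a0 mono xf yf; set d := (X in enorm X ^+ 2 <= _).
set X := stack x - stack y; set F := stack (pseudo_grad x) - stack (pseudo_grad y).
have -> : d = X - alpha *: F.
  by rewrite /d /X /F scalerBr !opprB addrACA [- _ + _]addrC addrACA.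
have FX : dotv F F <= (kappa1 + kappa2 * kappa3) ^+ 2 * enorm X ^+ 2.
  rewrite -sqr_enorm -exprMn; have := pseudo_grad_lipschitz xf yf.
  by move=> h; rewrite ler_pXn2r ?nnegrE ?enorm_ge0// (le_trans _ h) ?enorm_ge0.
have XF := mono x y xf yf; rewrite -/X -/F in XF.
clearbody X F; rewrite sqr_enorm dotvBl !dotvBr !dotvZl !dotvZr (dotvC F X).
rewrite -(sqr_enorm X).
have := ler_wpM2l a0 XF; have := ler_wpM2l (sqr_ge0 alpha) FX.
by rewrite !mulrA; lra.
Qed.

End GameEstimates.

(** Multiplied by [alpha], the step-size condition reads
    [2 alpha kappa2 kappa3 (2 + alpha mu) < L (1 - q^2)], where [L] stands for
    [beta * lambda2].  Since [1 + q < 2 + alpha mu], a factor [1 + q] cancels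
    and leaves [2 alpha kappa2 kappa3 < L (1 - q)], which is the last
    inequality once [c] is expanded. *)
Lemma step_size_conditions (R : rcfType) (mu alpha k L q kappa2 kappa3 : R) :
  0 < mu -> 0 < alpha -> 0 < kappa2 -> 0 < kappa3 -> 0 <= q ->
  2 * kappa2 * kappa3 < mu * L ->
  alpha * (k ^+ 2 * L + 2 * mu * kappa2 * kappa3)
    < 2 * mu * L - 4 * kappa2 * kappa3 ->
  q ^+ 2 = 1 - 2 * alpha * mu + alpha ^+ 2 * k ^+ 2 ->
  let c := kappa3 * (1 + q) / (alpha * kappa2) in
  [/\ q < 1, 0 < c, 0 < L - alpha * kappa2 * kappa3 &
      (kappa3 * (1 + q)) ^+ 2
      < c * (1 - q) * (L - alpha * kappa2 * kappa3)].
Proof.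
move=> mu0 a0 k20 k30 q0 hL ha hq c.
have K0 : 0 < kappa2 * kappa3 by rewrite mulr_gt0.
have L0 : 0 < L.
  by rewrite -(pmulr_rgt0 _ mu0) (lt_trans _ hL)// -mulrA mulr_gt0.
have aK : 0 < alpha * (kappa2 * kappa3) by rewrite mulr_gt0.
have key : 2 * (alpha * (kappa2 * kappa3)) * (2 + alpha * mu) < L * (1 - q ^+ 2).
  have := ha; rewrite -(ltr_pM2l a0) hq => h; lra.
have amu : 0 < alpha * mu by rewrite mulr_gt0.
have q1 : q < 1.
  have : 0 < L * (1 - q ^+ 2).
    by apply: lt_trans key; rewrite !mulr_gt0// addr_gt0.
  by rewrite pmulr_rgt0// subr_gt0 expr_lt1.
have q1' : 0 < 1 + q by rewrite ltr_wpDr.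
have key2 : 2 * (alpha * (kappa2 * kappa3)) < L * (1 - q).
  rewrite -(ltr_pM2r q1').
  have -> : L * (1 - q) * (1 + q) = L * (1 - q ^+ 2) by ring.
  by apply: le_lt_trans key; rewrite ler_pM2l ?mulr_gt0//; lra.
have B0 : 0 < L - alpha * kappa2 * kappa3.
  have : L * (1 - q) <= L by rewrite ler_piMr ?(ltW L0)//; lra.
  by rewrite -mulrA; lra.
have c0 : 0 < c by rewrite /c divr_gt0 ?mulr_gt0.
split => //.
have -> : (kappa3 * (1 + q)) ^+ 2 = c * (alpha * (kappa2 * kappa3) * (1 + q)).
  by rewrite /c; field; rewrite ?gt_eqF.
rewrite -[ltRHS]mulrA ltr_pM2l// -(mulrA alpha).
by lra.
Qed.

(** * Trajectories of the algorithm *)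

Lemma is_derive_sumf (R : realType) (V : normedModType R) (n : nat)
    (f : 'I_n -> R -> V) (t : R) (df : 'I_n -> V) :
  (forall i, is_derive t 1 (f i) (df i)) ->
  is_derive t 1 (fun s => \sum_(i < n) f i s) (\sum_(i < n) df i).
Proof.
move=> fd; have := is_derive_sum fd.
by congr is_derive; apply/funext => s; rewrite fct_sumE.
Qed.

Section Trajectory.
Context {R : realType} {N m : nat} {g : game R N m} {A : 'M[R]_N}.
Context {alpha beta : R} {x : R -> profile g} {theta : R -> 'I_N -> 'rV[R]_m}.
Context (N0 : (0 < N)%N) (hA1 : strategies_convex_closed g).
Context (hA2 : differentiable_game g) (Abal : weight_balanced A).
Context (sol : solution A alpha beta x theta).
Implicit Types (t s : R) (i : 'I_N).

Let eta t i : 'rV[R]_m := theta t i + phi g i (x t i).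

Definition target t : profile g :=
  fun i => eproj (strat g i) (x t i - alpha *: Gmap (x t i) (eta t i)).

Definition disagreement t i : 'rV[R]_m := eta t i - sigma (x t).

Lemma solution_feasible t : 0 <= t -> feasible (x t).
Proof.
move=> t0 i; have [x0 _ xc _ xd] := sol i; have [C0 Cc Ccl] := hA1 i.
apply: (@viability R _ _ (fun s => x s i) (fun s => target s i) Cc Ccl x0 xc _ t t0).
by move=> s s0; split; [exact: (eprojP _ C0 Cc Ccl).1|exact: (xd s s0).1].
Qed.

Lemma phi_derivable t i : 0 < t ->
  is_derive t 1 (fun s => phi g i (x s i)) ('D_1 (fun s => phi g i (x s i)) t).
Proof.
move=> t0; apply/derivableP; have [_ _ _ _ /(_ t t0)[[xd _] _]] := sol i.
have [_ phid] := hA2 i (x t).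
apply/derivable1_diffP.
apply: (@differentiable_comp _ _ _ _ (fun s => x s i) (phi g i)) => //.
exact/derivable1_diffP.
Qed.

(** The Lipschitz constant of [phi] on the strategy set bounds the drift of
    the local estimates because trajectories stay feasible. *)
Lemma phi_speed kappa1 kappa2 kappa3 t i : 0 <= kappa3 ->
  lipschitz_game g kappa1 kappa2 kappa3 -> 0 < t ->
  enorm ('D_1 (fun s => phi g i (x s i)) t)
  <= kappa3 * enorm (target t i - x t i).
Proof.
move=> k3 [_ _ lphi] t0; have [_ _ _ _ /(_ t t0)[xd _]] := sol i.
apply: (derive_lipschitz_bound k3 (lphi i) _ t0 xd); last exact: phi_derivable.
by move=> s s0; exact: solution_feasible.
Qed.

(** The flow of the estimates is a divergence: by weight balance the terms
    [a_ij (eta_j - eta_i)] sum to zero. *)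
Lemma sum_theta_eq0 t : 0 <= t -> \sum_i theta t i = 0.
Proof.
move=> t0; apply/rowP => k; rewrite summxE mxE.
have -> : \sum_i theta t i 0 k = \sum_i theta 0 i 0 k.
  apply: (@constant_of_zero_derive R (fun s => \sum_i theta s i 0 k)) => //.
    move=> s; apply: cvg_sum_seq => i; have [_ _ _ thc _] := sol i.
    exact: (cvg_comp _ _ (thc s) (@coord_continuous _ _ _ 0 k _)).
  move=> s s0.
  have thd i := is_derive_coord k
    (let: And5 _ _ _ _ h := sol i in (h s s0).2).
  apply: is_derive_eq (is_derive_sumf thd) _.
  rewrite -summxE -scaler_sumr mxE.
  have -> : \sum_i \sum_j A i j *: (eta s j - eta s i) = 0.
    have E (f : 'I_N -> 'rV[R]_m) :
        \sum_i \sum_j A i j *: f j = \sum_i \sum_j A i j *: f i.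
      rewrite exchange_big/=; apply: eq_bigr => i _.
      by rewrite -!scaler_suml; congr (_ *: _); rewrite -[RHS]/(d_in A i) Abal.
    under eq_bigr do (under eq_bigr do rewrite scalerBr; rewrite sumrB).
    by rewrite sumrB E subrr.
  by rewrite mxE mulr0.
by rewrite big1// => i _; have [_ -> _ _ _] := sol i; rewrite mxE.
Qed.

(** As the [theta t i] sum to zero, the estimates [eta] average to the exact
    aggregate. *)
Lemma sum_disagreement_eq0 t : 0 <= t -> \sum_i disagreement t i = 0.
Proof.
move=> t0; rewrite sumrB big_split/= sum_theta_eq0// add0r.
rewrite sumr_const card_ord -scaler_nat scalerA mulfV ?scale1r ?subrr//.
by rewrite pnatr_eq0 -lt0n.
Qed.

Lemma is_derive_dist (xs : profile g) t : 0 < t ->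
  is_derive t 1 (fun s => dotv (stack (x s) - stack xs) (stack (x s) - stack xs))
    (2 * dotv (stack (x t) - stack xs) (stack (target t) - stack (x t))).
Proof.
move=> t0.
have xd i : is_derive t 1 (fun s => dotv (x s i - xs i) (x s i - xs i))
    (2 * dotv (x t i - xs i) (target t i - x t i)).
  have [_ _ _ _ /(_ t t0)[xd _]] := sol i; apply: is_derive_dotvv.
  by apply: is_derive_eq (is_deriveB xd (is_derive_cst (xs i) t 1)) (subr0 _).
apply: is_derive_eq; last by rewrite !stackB dotv_stack mulr_sumr.
have := is_derive_sumf xd; congr is_derive; apply/funext => s.
by rewrite stackB dotv_stack.
Qed.

(** The derivative of the aggregate drops out: it is the same vector for all
    players and the disagreements sum to zero. *)
Lemma is_derive_disagreement t : 0 < t ->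
  is_derive t 1 (fun s => dotv (stack (disagreement s)) (stack (disagreement s)))
    (2 * (beta * (\sum_i dotv (disagreement t i)
           (\sum_j A i j *: (disagreement t j - disagreement t i)))
     + dotv (stack (disagreement t))
         (stack (fun i => 'D_1 (fun s => phi g i (x s i)) t)))).
Proof.
move=> t0; set dphi := fun i => 'D_1 (fun s => phi g i (x s i)) t.
pose flow i := beta *: \sum_j A i j *: (disagreement t j - disagreement t i).
pose dsigma := N%:R^-1 *: \sum_i dphi i.
have sd : is_derive t 1 (fun s => sigma (x s)) dsigma.
  apply: is_deriveZ; apply: is_derive_sumf => i; exact: phi_derivable.
have Yd i : is_derive t 1 (fun s => disagreement s i)
    (flow i + dphi i - dsigma).
  apply: is_deriveB => //; apply: is_deriveD; last exact: phi_derivable.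
  have [_ _ _ _ /(_ t t0)[_ thd]] := sol i.
  apply: is_derive_eq thd _; congr (_ *: _); apply: eq_bigr => j _.
  by rewrite /disagreement opprB addrA subrK.
have Y2d i := is_derive_dotvv (Yd i).
apply: is_derive_eq (_ : is_derive t 1 _ (\sum_i _)) _.
  have := is_derive_sumf Y2d; congr is_derive; apply/funext => s.
  by rewrite dotv_stack.
rewrite -mulr_sumr; congr (2 * _).
under eq_bigr do rewrite dotvBr dotvDr dotvZr.
rewrite sumrB big_split/= -mulr_sumr dotv_stack.
under [X in _ - X]eq_bigr do rewrite dotvC.
by rewrite -dotv_sumr sum_disagreement_eq0 ?ltW// dotvC dot0v subr0.
Qed.

Lemma within_continuous_sqr_stack (n : 'I_N -> nat)
    (u : R -> forall i, 'rV[R]_(n i)) :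
  (forall i, {within `[0, +oo[, continuous (fun s => u s i)}) ->
  {within `[0, +oo[, continuous (fun s => dotv (stack (u s)) (stack (u s)))}.
Proof.
move=> uc; have -> : (fun s => dotv (stack (u s)) (stack (u s))) =
    (fun s => \sum_i dotv (u s i) (u s i)).
  by apply/funext => s; rewrite dotv_stack.
by move=> s; apply: cvg_sum_seq => i; exact: within_continuous_dotv.
Qed.

Lemma continuous_dist (xs : profile g) :
  {within `[0, +oo[, continuous
     (fun s => dotv (stack (x s) - stack xs) (stack (x s) - stack xs))}.
Proof.
have -> : (fun s => dotv (stack (x s) - stack xs) (stack (x s) - stack xs)) =
   (fun s => dotv (stack (fun i => x s i - xs i)) (stack (fun i => x s i - xs i))).
  by apply/funext => s; rewrite stackB.
apply: within_continuous_sqr_stack => i s; have [_ _ xc _ _] := sol i.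
by apply: cvgB; [exact: xc|exact: cvg_cst].
Qed.

Lemma continuous_disagreement :
  {within `[0, +oo[, continuous
     (fun s => dotv (stack (disagreement s)) (stack (disagreement s)))}.
Proof.
have phic i : {within `[0, +oo[, continuous (fun s => phi g i (x s i))}.
  move=> s; have [_ _ xc _ _] := sol i.
  have [_ phid] := hA2 i (x s).
  exact: (cvg_comp _ _ (xc s) (differentiable_continuous phid)).
apply: within_continuous_sqr_stack => i s; have [_ _ _ thc _] := sol i.
apply: cvgB; first by apply: cvgD; [exact: thc|exact: phic].
apply: cvgZl_tmp.
by apply: cvg_sum_seq => j; exact: phic.
Qed.

End Trajectory.

Arguments target {R N m g} alpha x theta t i.
Arguments disagreement {R N m g} x theta t i.

(** * The Lyapunov function *)

Section Convergence.
Context {R : realType} {N m : nat} {g : game R N m} {A : 'M[R]_N}.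
Context {alpha beta mu kappa1 kappa2 kappa3 : R}.
Context {x : R -> profile g} {theta : R -> 'I_N -> 'rV[R]_m}.
Context (N0 : (0 < N)%N) (hA1 : strategies_convex_closed g).
Context (hA2 : differentiable_game g) (Abal : weight_balanced A).
Context (sol : solution A alpha beta x theta).
Context (alpha0 : 0 < alpha) (k20 : 0 < kappa2) (k30 : 0 < kappa3).
Context (gchain : partial_grads_chain_rule g).
Context (mono : strongly_monotone g mu).
Context (glip : lipschitz_game g kappa1 kappa2 kappa3).
Context {xs : profile g} (xs_nash : nash xs).
Implicit Types (t : R) (i : 'I_N).

(** The target projects an inexact gradient step from [x t], and [xs] is the
    projection of the exact gradient step from itself.  Projections do not
    expand, the exact step contracts by [q], and using the estimates in place
    of the aggregate costs [alpha * kappa2] times the disagreement. *)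
Lemma target_dist (q : R) t : 0 <= t -> 0 <= q ->
  q ^+ 2 = 1 - 2 * alpha * mu + alpha ^+ 2 * (kappa1 + kappa2 * kappa3) ^+ 2 ->
  enorm (stack (target alpha x theta t) - stack xs)
  <= q * enorm (stack (x t) - stack xs)
     + alpha * kappa2 * enorm (stack (disagreement x theta t)).
Proof.
move=> t0 q0 qE.
have xf := solution_feasible hA1 sol t0; have [xsf _] := xs_nash.
pose eta i : 'rV[R]_m := theta t i + phi g i (x t i).
pose Z1 := stack (x t) - alpha *: stack (Gall (x t) eta).
pose Z2 := stack xs - alpha *: stack (pseudo_grad xs).
have nonexp : enorm (stack (target alpha x theta t) - stack xs) <= enorm (Z1 - Z2).
  apply: projection_nonexpansive.
    rewrite /Z1 stackZ !stackB dotv_stack; apply: sumr_le0 => i _.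
    by have [C0 Cc Ccl] := hA1 i; exact: (eprojP _ C0 Cc Ccl).2.
  rewrite /Z2 stackZ !stackB dotv_stack; apply: sumr_le0 => i _.
  rewrite addrAC subrr add0r dotvNl dotvZl oppr_le0 mulr_ge0 ?(ltW alpha0)// dotvC.
  have [C0 Cc Ccl] := hA1 i; apply: nash_variational => //.
    by have [] := hA2 i xs.
  exact: (eprojP _ C0 Cc Ccl).1.
apply: (le_trans nonexp).
pose Zm := stack (x t) - alpha *: stack (pseudo_grad (x t)).
rewrite -(subrKA Zm) addrC; apply: le_trans (ler_enormD _ _) _; apply: lerD.
  rewrite -(@ler_pXn2r _ 2)// ?nnegrE ?mulr_ge0 ?enorm_ge0// exprMn qE.
  exact: (gradient_step_sqr (ltW k20) (ltW k30) gchain glip (ltW alpha0) mono xf xsf).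
have -> : Z1 - Zm = alpha *: (stack (pseudo_grad (x t)) - stack (Gall (x t) eta)).
  by rewrite /Z1 /Zm scalerBr opprB addrC addrA subrK.
rewrite enormZ ?(ltW alpha0)// -mulrA ler_pM2l// (pseudo_gradE gchain).
have [_ leta _] := glip.
apply: le_trans (leta (x t) (fun=> sigma (x t)) eta xf) _.
by rewrite ler_pM2l// enormBC stackB.
Qed.

(** Write [a] for the distance to the equilibrium and [b] for the norm of the
    disagreement.  The estimates are [a a' <= - (1 - q) a^2 + alpha kappa2 a b]
    and [b b' <= - beta lambda2 b^2 + kappa3 b ((1 + q) a + alpha kappa2 b)].
    The weight [c] makes the two contributions to the [a b] term equal; by the
    inequality of means, no other weight makes the resulting quadratic form
    positive definite under a weaker condition. *)
Lemma lyapunov_rate (e : rel 'I_N) (lambda2 q : R) :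
  is_adjacency e A -> strongly_connected e ->
  smallest_pos_eigenvalue (2^-1 *: (laplacian A + (laplacian A)^T)) lambda2 ->
  0 <= beta -> 0 <= q ->
  q ^+ 2 = 1 - 2 * alpha * mu + alpha ^+ 2 * (kappa1 + kappa2 * kappa3) ^+ 2 ->
  let c := kappa3 * (1 + q) / (alpha * kappa2) in
  forall t, 0 < t ->
  let a := enorm (stack (x t) - stack xs) in
  let b := enorm (stack (disagreement x theta t)) in
  exists2 dV, is_derive t 1 (fun s : R =>
      c * dotv (stack (x s) - stack xs) (stack (x s) - stack xs)
      + dotv (stack (disagreement x theta s)) (stack (disagreement x theta s))) dV
    & dV <= - 2 * (c * (1 - q) * a ^+ 2 - 2 * (kappa3 * (1 + q)) * a * b
               + (beta * lambda2 - alpha * kappa2 * kappa3) * b ^+ 2).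
Proof.
move=> Ae ec l2 beta0 q0 qE c t t0 a b.
have dD := is_deriveZ c (is_derive_dist sol xs t0).
have dY := is_derive_disagreement N0 hA2 Abal sol t0.
eexists; first exact: is_deriveD dD dY.
set P := stack (target alpha x theta t) in dD *.
set Y := disagreement x theta t in b dY *.
set dphi := stack (fun i => 'D_1 _ t) in dY *.
have a0 : 0 <= a by exact: enorm_ge0.
have b0 : 0 <= b by exact: enorm_ge0.
have c0 : 0 <= c by rewrite divr_ge0 ?mulr_ge0 ?addr_ge0// ltW.
have ca : c * (alpha * kappa2) = kappa3 * (1 + q).
  by rewrite divfK// mulf_neq0// gt_eqF.
have Ps : enorm (P - stack xs) <= q * a + alpha * kappa2 * b.
  exact: target_dist (ltW t0) q0 qE.
have PX : enorm (P - stack (x t)) <= (1 + q) * a + alpha * kappa2 * b.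
  rewrite -(subrKA (stack xs)); apply: le_trans (ler_enormD _ _) _.
  rewrite (enormBC (stack xs)) -/a; lra.
have XP : dotv (stack (x t) - stack xs) (P - stack (x t)) <=
    - (1 - q) * a ^+ 2 + alpha * kappa2 * a * b.
  have -> : P - stack (x t) = (P - stack xs) - (stack (x t) - stack xs).
    by rewrite opprB addrA subrK.
  rewrite dotvBr -(sqr_enorm (stack (x t) - stack xs)) -/a.
  have := dotv_cauchy_schwarz (stack (x t) - stack xs) (P - stack xs).
  by have := ler_wpM2l a0 Ps; rewrite -/a; lra.
have gap := laplacian_gap_stack Abal Ae ec l2
  (sum_disagreement_eq0 N0 Abal sol (ltW t0)).
rewrite -/Y -sqr_enorm -/b in gap.
have speed : dotv (stack Y) dphi <= b * (kappa3 * ((1 + q) * a + alpha * kappa2 * b)).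
  apply: le_trans (dotv_cauchy_schwarz _ _) _; rewrite -/b ler_wpM2l//.
  apply: (le_trans (y := kappa3 * enorm (P - stack (x t)))); last first.
    by rewrite ler_pM2l.
  rewrite /P stackB; apply: ler_enorm_stack; first exact: ltW.
  by move=> i; exact: (phi_speed hA1 hA2 sol i (ltW k30) glip t0).
have gap2 := ler_wpM2l beta0 gap.
have XP2 := ler_wpM2l c0 XP.
rewrite /GRing.scale/=.
have caab : c * (alpha * kappa2 * a * b) = kappa3 * (1 + q) * a * b.
  by rewrite -ca; ring.
by lra.
Qed.

End Convergence.

(** * Exponential convergence *)

Theorem theorem2 (R : realType) (N m : nat) (hN : (2 <= N)%N)
  (g : game R N m) (e : rel 'I_N) (A : 'M[R]_N)
  (mu kappa1 kappa2 kappa3 : R)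
  (hmu : 0 < mu) (hk1 : 0 < kappa1) (hk2 : 0 < kappa2) (hk3 : 0 < kappa3)
  (hgrad : partial_grads_chain_rule g)
  (hA1 : strategies_convex_closed g)
  (hA2 : differentiable_game g)
  (hA3 : strongly_monotone g mu)
  (hA4 : lipschitz_game g kappa1 kappa2 kappa3)
  (hadj : is_adjacency e A)
  (hA5 : strongly_connected e /\ weight_balanced A)
  (lambda2 : R)
  (hl2 : smallest_pos_eigenvalue
           (2^-1 *: (laplacian A + (laplacian A)^T)) lambda2)
  (kappa : R) (hkappa : kappa = kappa1 + kappa2 * kappa3)
  (alpha beta : R)
  (halpha0 : 0 < alpha)
  (halpha : alpha < (2 * mu * beta * lambda2 - 4 * kappa2 * kappa3)
                    / (kappa ^+ 2 * beta * lambda2 + 2 * mu * kappa2 * kappa3))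
  (hbeta : 2 * kappa2 * kappa3 / (mu * lambda2) < beta)
  (xstar : profile g) (hxstar : nash xstar) :
  exists gamma : R, 0 < gamma /\
    forall (x : R -> profile g) (theta : R -> 'I_N -> 'rV[R]_m),
      solution A alpha beta x theta ->
      exists C : R, 0 <= C /\
        forall t : R, 0 <= t ->
          enorm (stack (x t) - stack xstar) <= C * expR (- gamma * t).
Proof.
have [ec Abal] := hA5; have [l20 _ _] := hl2; have [xsf _] := hxstar.
have N0 : (0 < N)%N by exact: ltnW.
have K0 : 0 < kappa2 * kappa3 by rewrite mulr_gt0.
have beta0 : 0 < beta.
  by apply: lt_trans hbeta; rewrite divr_gt0 ?mulr_gt0.
have L0 : 0 < beta * lambda2 by rewrite mulr_gt0.
have kappa0 : 0 < kappa by rewrite hkappa addr_gt0.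
pose Q := 1 - 2 * alpha * mu + alpha ^+ 2 * kappa ^+ 2.
have [Q0|Q0] := leP 0 Q; last first.
  (* the gradient step then shrinks squared distances by a negative factor, so
     there is only one feasible profile *)
  exists 1; split => // x theta sol; exists 0; split => // t t0.
  have xf := solution_feasible hA1 sol t0.
  have := gradient_step_sqr (ltW hk2) (ltW hk3) hgrad hA4 (ltW halpha0) hA3 xf xsf.
  rewrite -hkappa -/Q mul0r => h.
  rewrite leNgt; apply/negP => a0; have := sqr_ge0 (enorm
    (stack (x t) - alpha *: stack (pseudo_grad (x t)) -
     (stack xstar - alpha *: stack (pseudo_grad xstar)))).
  by rewrite leNgt (le_lt_trans h)// nmulr_rlt0// exprn_gt0.
pose q := Num.sqrt Q.
have q0 : 0 <= q by exact: sqrtr_ge0.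
have qE : q ^+ 2 = 1 - 2 * alpha * mu + alpha ^+ 2 * kappa ^+ 2.
  exact: sqr_sqrtr.
have hL : 2 * kappa2 * kappa3 < mu * (beta * lambda2).
  by move: hbeta; rewrite ltr_pdivrMr ?mulr_gt0// mulrCA.
have ha : alpha * (kappa ^+ 2 * (beta * lambda2) + 2 * mu * kappa2 * kappa3)
    < 2 * mu * (beta * lambda2) - 4 * kappa2 * kappa3.
  by move: halpha; rewrite ltr_pdivlMr ?addr_gt0 ?mulr_gt0 ?exprn_gt0// !mulrA.
have [q1 c0 B0 disc] := step_size_conditions hmu halpha0 hk2 hk3 q0 hL ha qE.
set c := kappa3 * (1 + q) / (alpha * kappa2) in c0 disc.
have A0 : 0 < c * (1 - q) by rewrite mulr_gt0// subr_gt0.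
have [gamma gamma0 hgamma] := positive_definite_quadratic A0 B0 c0 disc.
exists gamma; split => // x theta sol.
pose V t := c * dotv (stack (x t) - stack xstar) (stack (x t) - stack xstar)
  + dotv (stack (disagreement x theta t)) (stack (disagreement x theta t)).
have V0 t : 0 <= V t.
  by apply: addr_ge0 (dotvv_ge0 _); apply: mulr_ge0 (ltW c0) (dotvv_ge0 _).
have Vc : {within `[0, +oo[, continuous V}.
  move=> s; apply: cvgD; last exact: continuous_disagreement hA2 sol s.
  by apply: cvgM; [exact: cvg_cst|exact: continuous_dist sol xstar s].
have Vd (t : R) : 0 < t ->
    exists2 dV, is_derive t 1 V dV & dV <= - (2 * gamma) * V t.
  move=> t0.
  have [|dV dVd dVle] := lyapunov_rate N0 hA1 hA2 Abal sol halpha0 hk2 hk3 hgrad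
    hA3 hA4 hxstar hadj ec hl2 (ltW beta0) q0 _ t0.
    by rewrite -hkappa.
  exists dV => //; apply: (le_trans dVle).
  rewrite /V -!sqr_enorm; have := hgamma (enorm (stack (x t) - stack xstar))
    (enorm (stack (disagreement x theta t))).
  by rewrite -/c; lra.
exists (Num.sqrt (V 0 / c)); split; first exact: sqrtr_ge0.
move=> t t0; apply: ler_enorm_sqr.
  by rewrite mulr_ge0 ?sqrtr_ge0 ?expR_ge0.
have Vc0 : 0 <= V 0 / c by rewrite divr_ge0 ?V0 ?(ltW c0).
rewrite exprMn (sqr_sqrtr Vc0) -expRM_natl.
have -> : 2%:R * (- gamma * t) = - (2 * gamma) * t by ring.
rewrite mulrAC ler_pdivlMr// mulrC; apply: (le_trans _ (gronwall_decay Vc Vd t0)).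
by rewrite /V lerDl; exact: dotvv_ge0.
Qed.
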